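(* Let $(E=E_{-n}\oplus\cdots\oplus E_{-1},\ \mu=l_1+\cdots+l_{n+1})$ be a symmetric Lie $n$-algebra. Let $N_1,\dots,N_r$ be symmetric vector valued $k_1$-,$\dots$,$k_r$-forms on $E$, respectively, all of degree zero, with $\frac{n+3}{2}\le k_1\le\cdots\le k_r\le n+1$. Let $S:E\to E$ be the Euler map, $S(X)=-|X|X$ for homogeneous $X$. Then $\mathcal N=S+\sum_{i=1}^rN_i$ is a Nijenhuis vector valued form with respect to $\mu$, with square $S+2\sum_{i=1}^rN_i$. The deformed Lie $n$-algebra structure is $$\Big[S+\sum_{i=1}^rN_i,\ \mu\Big]_{_{RN}}=\mu+\sum_{i=1}^r\ \sum_{m=1}^{n-k_i+2}[N_i,l_m]_{_{RN}}.$$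
   Context: Base field $\mathbb K=\mathbb R$ or $\mathbb C$; $|X|$ is the degree of a homogeneous $X\in E$. A symmetric vector valued $k$-form ($k\ge 0$) is a graded symmetric $k$-linear map $K:E\times\cdots\times E\to E$ (for $k=0$, an element of $E$). It has degree $\bar K$ if $|K(X_1,\dots,X_k)|=|X_1|+\cdots+|X_k|+\bar K$. A symmetric vector valued form is a formal sum $\sum_{k\ge0}K_k$ of vector valued $k$-forms; it has degree $d$ if all $K_k$ do. Insertion: for a $k$-form $K$ and an $l$-form $L$ with $l\ge1$, $$\iota_KL(X_1,\dots,X_{k+l-1})=\sum_{\sigma\in Sh(k,l-1)}\epsilon(\sigma)L(K(X_{\sigma(1)},\dots,X_{\sigma(k)}),X_{\sigma(k+1)},\dots,X_{\sigma(k+l-1)}),$$ where $Sh(k,l-1)$ is the set of $(k,l-1)$-unshuffles and $\epsilon(\sigma)$ is the Koszul sign ($X_{\sigma(1)}\cdots X_{\sigma(n)}=\epsilon(\sigma)X_1\cdots X_n$ in the graded symmetric algebra); $\iota_KL=0$ if $L\in E$; $\iota_XK=K(X,\cdot,\dots,\cdot)$ for $X\in E$. Richardson-Nijenhuis bracket: $[K,L]_{_{RN}}=\iota_KL-(-1)^{\bar K\bar L}\iota_LK$, extended to formal sums. An $L_\infty$-structure is a sum $\mu=\sum_{i\ge1}l_i$ of symmetric vector valued $i$-forms $l_i$ of degree $1$ with $\sum_{i+j=m+1}\sum_{\sigma\in Sh(i,j-1)}\epsilon(\sigma)l_j(l_i(X_{\sigma(1)},\dots,X_{\sigma(i)}),\dots,X_{\sigma(m)})=0$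 for all $m\ge1$. A symmetric Lie $n$-algebra is an $L_\infty$-structure on a graded vector space concentrated in degrees $-n,\dots,-1$ (then $l_i=0$ for $i\ge n+2$ for degree reasons). For a form $\mu$ of degree $1$, a form $\mathcal N$ of degree zero is Nijenhuis with respect to $\mu$ with square $\mathcal K$ if $\mathcal K$ is a vector valued form of degree zero with $[\mathcal N,[\mathcal N,\mu]_{_{RN}}]_{_{RN}}=[\mathcal K,\mu]_{_{RN}}$ and $[\mathcal N,\mathcal K]_{_{RN}}=0$. The deformed structure is $[\mathcal N,\mu]_{_{RN}}$. *)

(* Defs.v *)
From mathcomp Require Import all_boot all_order all_fingroup all_algebra.
From mathcomp Require Import functions reals complex.

Set Implicit Arguments.
Unset Strict Implicit.
Unset Printing Implicit Defensive.

Import Order.TTheory GRing.Theory Num.Theory.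
Local Open Scope ring_scope.

Variant base_field := RealBase | ComplexBase.

Definition scalars (R : realType) (b : base_field) : numFieldType :=
  match b with
  | RealBase => R : numFieldType
  | ComplexBase => R[i] : numFieldType
  end.

(* A Z-graded vector space, as an internal direct sum: [gproj i] is the        *)
(* projection onto the component E_i, and every vector is the sum of finitely  *)
(* many of its components.                                                     *)
Record gradedSpace (F : fieldType) := GradedSpace {
  gcarrier :> lmodType F;
  gproj : int -> {linear gcarrier -> gcarrier};
  gproj_comp : forall i j x,
    gproj i (gproj j x) = if i == j then gproj j x else 0;
  gproj_sum : forall x, exists s : seq int,
    uniq s && (x == \sum_(i <- s) gproj i x)
}.

(* A finite set of degrees containing all those i with [gproj i x != 0].       *)
Definition gsupp (F : fieldType) (E : gradedSpace F) (x : E) : seq int :=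
  xchoose (gproj_sum x).

(* x belongs to E_i; the zero vector is homogeneous of every degree.           *)
Definition homog (F : fieldType) (E : gradedSpace F) (i : int) (x : E) : bool :=
  gproj E i x == x.

Definition concentrated (F : fieldType) (E : gradedSpace F) (a b : int) : Prop :=
  forall (i : int) (x : E), homog i x -> x != 0 -> (a <= i <= b).

(* A formal sum of maps K_k : E^k -> E, one for each k >= 0, is encoded as a   *)
(* single function on lists, K_k being its restriction to lists of length k.   *)
(* [arity_part k K] is K_k, seen as the formal sum with this single term.      *)
Definition arity_part (F : fieldType) (E : gradedSpace F) (k : nat)
    (K : seq E -> E) : seq E -> E :=
  fun X => if size X == k then K X else 0.

Definition multilinear (F : fieldType) (E : gradedSpace F) (K : seq E -> E) :
    Prop :=
  forall (s t : seq E) (a : F) (x y : E),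
    K (s ++ (a *: x + y) :: t) = a *: K (s ++ x :: t) + K (s ++ y :: t).

Definition graded_symmetric (F : fieldType) (E : gradedSpace F)
    (K : seq E -> E) : Prop :=
  forall (s t : seq E) (i j : int) (x y : E), homog i x -> homog j y ->
    K (s ++ x :: y :: t) = (-1) ^ (i * j) *: K (s ++ y :: x :: t).

Definition vector_form (F : fieldType) (E : gradedSpace F) (K : seq E -> E) :
    Prop :=
  multilinear K /\ graded_symmetric K.

Definition vector_kform (F : fieldType) (E : gradedSpace F) (k : nat)
    (K : seq E -> E) : Prop :=
  vector_form K /\ (forall X : seq E, size X != k -> K X = 0).

(* Lists of homogeneous vectors, each paired with its degree.                  *)
Definition homog_list (F : fieldType) (E : gradedSpace F)
    (Y : seq (int * E)) : bool :=
  all (fun y => homog y.1 y.2) Y.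

Definition of_degree (F : fieldType) (E : gradedSpace F) (d : int)
    (K : seq E -> E) : Prop :=
  forall Y : seq (int * E), homog_list Y ->
    homog (\sum_(y <- Y) y.1 + d) (K (unzip2 Y)).

(* s is a (k, m - k)-unshuffle: increasing on [0, k) and on [k, m).            *)
Definition unshuffle (m k : nat) (s : 'S_m) : bool :=
  [forall i : 'I_m, forall j : 'I_m, (i < j)%N && ((j < k) || (k <= i))%N ==> (s i < s j)%N].

(* The sign with X_(s 0) ... X_(s (m-1)) = koszul d s . X_0 ... X_(m-1) in the *)
(* graded symmetric algebra, where |X_i| = d i: sorting the left-hand side     *)
(* exchanges exactly the pairs inverted by s.                                  *)
Definition koszul (F : fieldType) (m : nat) (d : 'I_m -> int) (s : 'S_m) : F :=
  \prod_(i < m) \prod_(j < m | (i < j)%N && (s j < s i)%N)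
    (-1) ^ (d (s i) * d (s j)).

(* The sum over Sh(k, m - k) defining the insertion of the k-ary part of K     *)
(* into the (m - k + 1)-ary part of L, at homogeneous vectors Y_0 ... Y_(m-1). *)
Definition insert_at (F : fieldType) (E : gradedSpace F) (k : nat)
    (K L : seq E -> E) (Y : seq (int * E)) : E :=
  \sum_(s : 'S_(size Y) | unshuffle k s)
    let Z := [seq (nth (0, 0) Y (s i)).2 | i <- enum 'I_(size Y)] in
    koszul F (fun i : 'I_(size Y) => (nth (0, 0) Y i).1) s
      *: L (K (take k Z) :: drop k Z).

(* All lists obtained from X by replacing each vector by one of its            *)
(* homogeneous components.                                                     *)
Fixpoint components (F : fieldType) (E : gradedSpace F) (X : seq E) :
    seq (seq (int * E)) :=
  if X is x :: X' then
    [seq (i, gproj E i x) :: Y | i <- gsupp x, Y <- components X']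
  else [:: [::]].

(* The insertion iota_K L of formal sums; the formula for homogeneous vectors  *)
(* is extended multilinearly to all of E.                                      *)
Definition insertion (F : fieldType) (E : gradedSpace F) (K L : seq E -> E) :
    seq E -> E :=
  fun X => \sum_(Y <- components X) \sum_(k < (size X).+1) insert_at k K L Y.

(* [K, L]_RN for K of degree dK and L of degree dL.                            *)
Definition rn_bracket (F : fieldType) (E : gradedSpace F) (dK dL : int)
    (K L : seq E -> E) : seq E -> E :=
  insertion K L - (-1) ^ (dK * dL) *: insertion L K.

Definition linfty_structure (F : fieldType) (E : gradedSpace F)
    (mu : seq E -> E) : Prop :=
  [/\ vector_form mu, of_degree 1 mu, mu [::] = 0 &
      forall Y : seq (int * E), homog_list Y -> (1 <= size Y)%N ->
        \sum_(1 <= i < (size Y).+1) insert_at i mu mu Y = 0].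

Definition lie_n_algebra (F : fieldType) (n : nat) (E : gradedSpace F)
    (mu : seq E -> E) : Prop :=
  concentrated E (- n%:Z) (- 1) /\ linfty_structure mu.

(* N is Nijenhuis with respect to mu (of degree 1), with square K.             *)
Definition nijenhuis (F : fieldType) (E : gradedSpace F)
    (mu N K : seq E -> E) : Prop :=
  [/\ vector_form N /\ of_degree 0 N,
      vector_form K /\ of_degree 0 K,
      rn_bracket 0 1 N (rn_bracket 0 1 N mu) = rn_bracket 0 1 K mu &
      rn_bracket 0 0 N K = 0].

Definition euler (F : fieldType) (E : gradedSpace F) : seq E -> E :=
  fun X => if X is [:: x] then \sum_(i <- gsupp x) (- i)%:~R *: gproj E i x
           else 0.
Arguments euler {F} E _.

(* Main.v *)
(* The insertion is a graded pre-Lie product, so [.,.]_RN satisfies the graded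
   Jacobi identity. The Euler map acts by [S, K] = |K| K. With M = sum_i N_i,
   a form of degree d and arity q vanishes as soon as q > n + d, which kills
   [M, [M, mu]]; hence [S + M, mu] = mu + [M, mu] and
   [S + M, [S + M, mu]] = mu + 2 [M, mu] = [S + 2 M, mu]. That the deformed
   bracket nu = [N, mu] squares to zero holds for any Nijenhuis form N with
   square K: [mu, nu] = 0, hence
   [nu, nu] = [N, [mu, nu]] - [mu, [N, nu]] = - [mu, [K, mu]] = 0. *)

Require Import Defs.
From mathcomp Require Import all_boot all_order all_fingroup all_algebra.
From mathcomp Require Import ring zify.
From mathcomp Require Import boolp functions reals complex.

Import Order.TTheory GRing.Theory Num.Theory.
Local Open Scope ring_scope.

Set Implicit Arguments.
Unset Strict Implicit.
Unset Printing Implicit Defensive.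

(** * Koszul-signed sums over splittings of a list *)

(** The definition of insertion sums over permutations and over chosen homogeneous components, a
    form in which two insertions are hard to compose. Both sums are replaced once and for all. On a
    homogeneous list the unshuffle sum becomes the recursive [split_sum], which decides entry by
    entry which factor receives it; its coassociativity and cocommutativity carry the pre-Lie
    identity. All forms involved are multilinear, so identities between them need only be compared
    on homogeneous lists. The bound on the k_i serves to kill [M, [M, mu]]. If M starts in arity p,
    then, as mu starts in arity 1 and an insertion loses one slot, [M, mu] starts in arity p and [M,
    [M, mu]] in arity 2p - 1. A form of degree 1 vanishes above arity n + 1, and n + 3 <= 2p gives
    2p - 1 >= n + 2. *)

Lemma reindex_lift_perm (V : nmodType) m (i0 j0 : 'I_m.+1)
    (P : pred 'S_m.+1) (G : 'S_m.+1 -> V) :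
  \sum_(s | P s && (s i0 == j0)) G s
    = \sum_(s | P (lift_perm i0 j0 s)) G (lift_perm i0 j0 s).
Proof.
rewrite (reindex (lift_perm i0 j0)).
  by apply: eq_bigl => s; rewrite lift_perm_id eqxx andbT.
(* [u i s] is [s] with [i] removed from the source and [s i] from the target. The default of [odflt]
   is never reached, as [uK] shows; the same construction on the inverse permutation inverts
   [u i0 s]. *)
pose u i (s : 'S_m.+1) k := odflt k (unlift (s i) (s (lift i k))).
have uK i (s : 'S_m.+1) k : lift (s i) (u i s k) = s (lift i k).
  rewrite /u; have := neq_lift i k.
  by rewrite -(can_eq (permK s)) => /unlift_some[] ? ? ->.
have inj_u : injective (u i0 _).
  move=> s; apply: can_inj (u (s i0) s^-1%g) _ => k'.
  by rewrite {1}/u uK !permK liftK.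
exists (fun s => perm (@inj_u s)) => [s _ | s].
  by apply/permP => k'; rewrite permE /u lift_perm_lift lift_perm_id liftK.
case/andP=> _ /eqP si0; apply/permP => k.
case: (unliftP i0 k) => [k'|] ->; rewrite ?lift_perm_id //.
by rewrite lift_perm_lift -si0 permE uK.
Qed.

Section SplitSum.

Variables (F : fieldType) (E : gradedSpace F).
Local Notation hvec := (int * gcarrier E)%type.
Implicit Types (A B X Y s t : seq hvec) (f g : seq hvec -> seq hvec -> E).

Definition ksign (a b : int) : F := (-1) ^ (a * b).

Lemma ksignDl a b c : ksign (a + b) c = ksign a c * ksign b c.
Proof. by rewrite /ksign mulrDl expfzDr // oppr_eq0 oner_neq0. Qed.

Lemma ksignDr a b c : ksign a (b + c) = ksign a b * ksign a c.
Proof. by rewrite /ksign mulrDr expfzDr // oppr_eq0 oner_neq0. Qed.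

Lemma ksignC a b : ksign a b = ksign b a.
Proof. by rewrite /ksign mulrC. Qed.

Lemma ksignK a b : ksign a b * ksign a b = 1.
Proof. by rewrite /ksign -expfzMl mulrNN mulr1 exp1rz. Qed.

Lemma ksign0r a : ksign a 0 = 1.
Proof. by rewrite /ksign mulr0. Qed.

Definition sdeg Y : int := \sum_(y <- Y) y.1.

Lemma sdeg_nil : sdeg [::] = 0.
Proof. exact: big_nil. Qed.

Lemma sdeg_cons y Y : sdeg (y :: Y) = y.1 + sdeg Y.
Proof. exact: big_cons. Qed.

Lemma sdeg_swap s x y t : sdeg (s ++ x :: y :: t) = sdeg (s ++ y :: x :: t).
Proof. by rewrite /sdeg !big_cat !big_cons /= [in LHS](addrCA x.1). Qed.

(* f summed against the unshuffle coproduct of the symmetric coalgebra: the *)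
(* head of Y either stays in the left factor A, or moves past A into B. *)
Fixpoint split_sum f Y : E :=
  if Y is y :: Y' then
    split_sum (fun A B => f (y :: A) B) Y'
    + split_sum (fun A B => ksign y.1 (sdeg A) *: f A (y :: B)) Y'
  else f [::] [::].

(** Only splittings that can occur are compared: the size equation serves arity arguments, the
    degree equation serves Koszul signs, and [p] carries homogeneity. *)
Lemma eq_split_sum_all (p : pred hvec) f g Y : all p Y ->
    (forall A B, all p A -> all p B -> (size A + size B = size Y)%N ->
       sdeg A + sdeg B = sdeg Y -> f A B = g A B) ->
  split_sum f Y = split_sum g Y.
Proof.
elim: Y f g => [|y Y IH] f g /=.
  by move=> _ fg; apply: fg; rewrite ?sdeg_nil.
case/andP=> py pY fg; congr (_ + _); apply: IH => // A B pA pB sAB dAB.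
- by apply: fg; rewrite /= ?py ?pA // ?addSn ?sAB // !sdeg_cons -addrA dAB.
- congr (_ *: _); apply: fg; rewrite /= ?py ?pB // ?addnS ?sAB //.
  by rewrite !sdeg_cons addrCA dAB.
Qed.

Lemma eq_split_sum f g Y :
    (forall A B, (size A + size B = size Y)%N -> sdeg A + sdeg B = sdeg Y ->
       f A B = g A B) ->
  split_sum f Y = split_sum g Y.
Proof.
move=> fg; apply: (@eq_split_sum_all predT) => [|A B _ _]; last exact: fg.
exact: all_predT.
Qed.

Lemma split_sumD f g Y :
  split_sum (fun A B => f A B + g A B) Y = split_sum f Y + split_sum g Y.
Proof.
elim: Y f g => //= y Y IH f g; rewrite IH addrACA; congr (_ + _).
by rewrite -IH; apply: eq_split_sum => A B _ _; rewrite scalerDr.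
Qed.

Lemma split_sumZ c f Y :
  split_sum (fun A B => c *: f A B) Y = c *: split_sum f Y.
Proof.
elim: Y f => //= y Y IH f; rewrite IH scalerDr; congr (_ + _).
by rewrite -IH; apply: eq_split_sum => A B _ _; rewrite !scalerA mulrC.
Qed.

Lemma split_sum0 Y : split_sum (fun _ _ => 0) Y = 0.
Proof.
rewrite -[RHS](scale0r (split_sum (fun _ _ => 0) Y)) -split_sumZ.
by apply: eq_split_sum => A B _ _; rewrite scaler0.
Qed.

Lemma split_sum_sum (I : Type) (r : seq I)
    (f : I -> seq hvec -> seq hvec -> E) Y :
  split_sum (fun A B => \sum_(i <- r) f i A B) Y
    = \sum_(i <- r) split_sum (f i) Y.
Proof.
elim: r => [|i r IH].
  rewrite big_nil -[RHS](split_sum0 Y); apply: eq_split_sum => A B _ _.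
  by rewrite big_nil.
rewrite big_cons -IH -split_sumD; apply: eq_split_sum => A B _ _.
by rewrite big_cons.
Qed.

Lemma split_sum_left_nil f Y :
    (forall A B, A <> [::] -> f A B = 0) -> split_sum f Y = f [::] Y.
Proof.
elim: Y f => //= y Y IH f f0.
rewrite (eq_split_sum (g := fun _ _ => 0)) ?split_sum0 ?add0r => [|*];
  last exact: f0.
rewrite IH ?sdeg_nil ?ksign0r ?scale1r // => A B nA.
by rewrite f0 ?scaler0.
Qed.

Lemma split_sum_right_nil f Y :
    (forall A B, B <> [::] -> f A B = 0) -> split_sum f Y = f Y [::].
Proof.
elim: Y f => //= y Y IH f f0.
rewrite addrC (eq_split_sum (g := fun _ _ => 0)) ?split_sum0 ?add0r => [|*].
  by apply: IH => A B; apply: f0.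
by rewrite f0 ?scaler0.
Qed.

(** Both sides distribute [Y] over three factors. An entry bound for the third one passes the first
    two, at once on the left-hand side and one after the other on the right-hand side. *)
Lemma split_sum_coassoc (h : seq hvec -> seq hvec -> seq hvec -> E) Y :
  split_sum (fun P R => split_sum (fun A B => h A B R) P) Y
    = split_sum (fun P R => split_sum (fun A B => h P A B) R) Y.
Proof.
elim: Y h => //= y Y IH h; rewrite !split_sumD -addrA; congr (_ + _).
  exact: (IH (fun A => h (y :: A))).
pose h1 A B C := ksign y.1 (sdeg A) *: h A (y :: B) C.
pose h2 A B C := ksign y.1 (sdeg A + sdeg B) *: h A B (y :: C).
transitivity (split_sum (fun P R => split_sum (fun A B => h1 A B R) P) Y
   + split_sum (fun P R => split_sum (fun A B => h2 A B R) P) Y).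
  congr (_ + _); apply: eq_split_sum => P R _ _.
  rewrite -split_sumZ; apply: eq_split_sum => A B _ dAB.
  by rewrite /h2 dAB.
rewrite !IH -split_sumD; apply: eq_split_sum => P R _ _.
rewrite scalerDr -!split_sumZ; congr (_ + _).
apply: eq_split_sum => A B _ _.
by rewrite scalerA /h2 ksignDr.
Qed.

Lemma split_sum_cocomm f Y :
  split_sum f Y
    = split_sum (fun A B => ksign (sdeg A) (sdeg B) *: f B A) Y.
Proof.
elim: Y f => /= [|y Y IH] f; first by rewrite sdeg_nil ksign0r scale1r.
rewrite addrC; congr (_ + _); rewrite IH; apply: eq_split_sum => A B _ _.
  by rewrite scalerA sdeg_cons ksignDl [ksign (sdeg A) _ * _]mulrC.
rewrite scalerA sdeg_cons ksignDr mulrA [ksign (sdeg A) y.1]ksignC.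
by rewrite ksignK mul1r.
Qed.

(** If [x] and [y] land in the same factor, the hypotheses on [f] apply. The two terms that separate
    them trade places, and their signs differ exactly by that of exchanging [x] and [y]. *)
Lemma split_sum_swap f s t x y :
    (forall s t B, f (s ++ x :: y :: t) B
       = ksign x.1 y.1 *: f (s ++ y :: x :: t) B) ->
    (forall A s t, f A (s ++ x :: y :: t)
       = ksign x.1 y.1 *: f A (s ++ y :: x :: t)) ->
  split_sum f (s ++ x :: y :: t)
    = ksign x.1 y.1 *: split_sum f (s ++ y :: x :: t).
Proof.
elim: s f => [|z s IH] f fl fr /=.
  rewrite !scalerDr -!split_sumZ -!addrA.
  congr (_ + _); last rewrite addrCA; last congr (_ + (_ + _));
    apply: eq_split_sum => A B _ _.
  - exact: (fl [::]).
  - by rewrite sdeg_cons ksignDr scalerA.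
  - rewrite scalerA sdeg_cons ksignDr mulrA [ksign x.1 y.1]ksignC.
    by rewrite ksignK mul1r.
  - rewrite (fr _ [::]) !scalerA; congr (_ *: _).
    by rewrite [LHS]mulrC; congr (_ * _); apply: mulrC.
rewrite scalerDr; congr (_ + _); apply: IH => /= [s' t' B|A s' t'].
- exact: (fl (z :: s')).
- exact: fr.
- by rewrite fl !scalerA sdeg_swap mulrC.
- by rewrite (fr _ (z :: s')) !scalerA mulrC.
Qed.

Lemma split_sum_linear f s t i (a : F) (x y : E) :
    (forall s t B, f (s ++ (i, a *: x + y) :: t) B
       = a *: f (s ++ (i, x) :: t) B + f (s ++ (i, y) :: t) B) ->
    (forall A s t, f A (s ++ (i, a *: x + y) :: t)
       = a *: f A (s ++ (i, x) :: t) + f A (s ++ (i, y) :: t)) ->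
  split_sum f (s ++ (i, a *: x + y) :: t)
    = a *: split_sum f (s ++ (i, x) :: t) + split_sum f (s ++ (i, y) :: t).
Proof.
have sd (s' t' : seq hvec) (u v : E) :
    sdeg (s' ++ (i, u) :: t') = sdeg (s' ++ (i, v) :: t').
  by rewrite /sdeg !big_cat !big_cons.
elim: s f => [|z s IH] f fl fr /=; rewrite scalerDr addrACA.
  congr (_ + _); rewrite -split_sumZ -split_sumD;
    apply: eq_split_sum => A B _ _.
    exact: (fl [::]).
  by rewrite (fr _ [::]) scalerDr !scalerA mulrC.
congr (_ + _); apply: IH => /= [s' t' B|A s' t'].
- exact: (fl (z :: s')).
- exact: fr.
- rewrite fl scalerDr !scalerA (sd s' t' (a *: x + y) x) (sd s' t' y x).
  by rewrite mulrC.
- by rewrite (fr _ (z :: s')) scalerDr !scalerA mulrC.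
Qed.

End SplitSum.

(** * Sums over unshuffles *)

Section Unshuffles.

Variables (F : fieldType) (E : gradedSpace F).
Local Notation hvec := (int * gcarrier E)%type.
Implicit Types (A B X Y s t : seq hvec).

Definition perm_list m Y (s : 'S_m) : seq hvec :=
  [seq nth (0, 0) Y (s i) | i <- enum 'I_m].

Lemma size_perm_list m Y (s : 'S_m) : size (perm_list Y s) = m.
Proof. by rewrite size_map size_enum_ord. Qed.

Lemma nth_perm_list m Y (s : 'S_m) (i : 'I_m) :
  nth (0, 0) (perm_list Y s) i = nth (0, 0) Y (s i).
Proof. by rewrite (nth_map i) ?size_enum_ord // nth_ord_enum. Qed.

Lemma ltn_lift m (p : 'I_m.+1) (i j : 'I_m) :
  (lift p i < lift p j)%N = (i < j)%N.
Proof. by rewrite !ltnNge leq_bump2. Qed.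

Lemma lift_ltn m (p : 'I_m.+1) (i : 'I_m) : (lift p i < p)%N = (i < p)%N.
Proof.
rewrite /= /bump; case: (leqP p i) => h /=; last by rewrite h.
by rewrite add1n ltnNge (leq_trans h).
Qed.

Lemma perm_list_lift m Y y (p : 'I_m.+1) (s : 'S_m) :
  perm_list (y :: Y) (lift_perm p ord0 s)
    = take p (perm_list Y s) ++ y :: drop p (perm_list Y s).
Proof.
have pm : (p <= m)%N by rewrite -ltnS.
have sz : size (take p (perm_list Y s)) = p.
  by rewrite size_takel // size_perm_list.
apply: (@eq_from_nth _ (0, 0)) => [|i].
  by rewrite size_cat /= sz size_drop !size_perm_list addnS subnKC.
rewrite size_perm_list => im; rewrite -[ i ]/(val (Ordinal im)) nth_perm_list.
rewrite nth_cat sz; case: (unliftP p (Ordinal im)) => [j|] ->.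
  rewrite lift_perm_lift lift_ltn /= /bump.
  case: ltnP => h; first by rewrite add0n nth_take // nth_perm_list.
  by rewrite add1n subSn //= nth_drop subnKC // nth_perm_list.
by rewrite lift_perm_id ltnn subnn.
Qed.

Lemma sdeg_take_perm_list m k Y (s : 'S_m) : (k <= m)%N ->
  sdeg (take k (perm_list Y s))
    = \sum_(i < m | (i < k)%N) (nth (0, 0) Y (s i)).1.
Proof.
move=> km; rewrite /sdeg (big_nth (0, 0)) size_takel ?size_perm_list //.
rewrite big_mkord (eq_bigr (fun i : 'I_k => (nth (0, 0) (perm_list Y s) i).1)).
  rewrite (big_ord_widen m (fun i => (nth (0, 0) (perm_list Y s) i).1)) //.
  by apply: eq_bigr => i _; rewrite nth_perm_list.
by move=> i _; rewrite nth_take.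
Qed.

(** Index 0 at position [p] is inverted exactly with the [p] positions before it; every other
    inversion comes from [s]. *)
Lemma koszul_lift_perm m (d : 'I_m.+1 -> int) (p : 'I_m.+1) (s : 'S_m) :
  koszul F d (lift_perm p ord0 s)
    = ksign F (d ord0) (\sum_(i < m | (i < p)%N) d (lift ord0 (s i)))
      * koszul F (fun i => d (lift ord0 i)) s.
Proof.
rewrite /koszul (bigD1_ord p) //= big1 ?mul1r; last first.
  by move=> j; rewrite lift_perm_id ltn0 andbF.
rewrite (big_morph (ksign F (d ord0)) (ksignDr F _) (ksign0r F _)).
rewrite [in RHS]big_mkcond -big_split; apply: eq_bigr => i _ /=.
rewrite big_mkcond (bigD1_ord p) //= lift_ltn lift_perm_id lift_perm_lift.
rewrite andbT /ksign [d (lift _ _) * d ord0]mulrC; congr (_ * _).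
rewrite [RHS]big_mkcond; apply: eq_bigr => j _.
by rewrite lift_perm_lift !ltn_lift.
Qed.

(** [k'] is the block boundary once position [p] is deleted. Index 0 at the head of a block lies
    below everything that follows, so it adds no condition. *)
Lemma unshuffle_lift_perm m k k' (p : 'I_m.+1) (s : 'S_m) :
    (p == 0%N :> nat) || (p == k :> nat) ->
    (forall j : 'I_m, (lift p j < k)%N = (j < k')%N) ->
  unshuffle k (lift_perm p ord0 s) = unshuffle k' s.
Proof.
move=> hp hk.
apply/forallP/forallP => us i; apply/forallP => j; apply/implyP.
  move: (forallP (us (lift p i)) (lift p j)).
  rewrite !lift_perm_lift !ltn_lift hk [(k <= _)%N]leqNgt hk -leqNgt.
  by move/implyP.
case: (unliftP p i) => [i'|] ->; case: (unliftP p j) => [j'|] ->.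
- rewrite !lift_perm_lift !ltn_lift hk [(k <= _)%N]leqNgt hk -leqNgt.
  exact: (implyP (forallP (us i') j')).
- rewrite lift_ltn => /andP[ip]; case/orP: hp => /eqP hp.
    by rewrite hp ltn0 in ip.
  by rewrite -hp ltnn orFb leqNgt lift_ltn ip.
- by rewrite lift_perm_id lift_perm_lift.
- by rewrite ltnn.
Qed.

(** The values increase on each block, so the smallest one can only stand at the head of a block. *)
Lemma unshuffle_preim0 m k (p : 'I_m.+1) (s : 'S_m.+1) :
  unshuffle k s -> s p = ord0 -> (p == 0%N :> nat) || (p == k :> nat).
Proof.
move=> us sp; apply/norP => -[p0 pk].
have {}us (i : 'I_m.+1) : (i < p)%N -> (p < k)%N || (k <= i)%N -> False.
  move=> ip h; have := forallP (forallP us i) p.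
  by rewrite ip h sp.
case: (ltngtP p k) pk => // pk _.
  by apply: (us ord0); rewrite ?pk // lt0n.
by apply: (us (Ordinal (ltn_trans pk (ltn_ord p)))); rewrite /= ?leqnn ?orbT.
Qed.

(** Induction on [Y], sorting the unshuffles by the position of index 0: position 0 puts the head of
    [Y] into the first block, position [k] into the second, and deleting it leaves an unshuffle of
    the tail. These are the two summands in the recursion of [split_sum]. *)
Lemma sum_unshuffle k Y (g : seq hvec -> seq hvec -> E) : (k <= size Y)%N ->
  \sum_(s : 'S_(size Y) | unshuffle k s)
      koszul F (fun i : 'I_(size Y) => (nth (0, 0) Y i).1) s
        *: g (take k (perm_list Y s)) (drop k (perm_list Y s))
    = split_sum (fun A B => if size A == k then g A B else 0) Y.
Proof.
elim: Y k g => [|y Y IH] k g /=.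
  rewrite leqn0 => /eqP ->.
  rewrite (bigD1 1%g) /=; last by apply/forallP; case.
  rewrite big1 ?addr0 => [|s /andP[_ /eqP[]]]; last by apply/permP; case.
  by rewrite /koszul big_ord0 scale1r /perm_list enum_ord0.
set m := size Y => km.
pose H (s : 'S_m.+1) :=
  koszul F (fun i : 'I_m.+1 => (nth (0, 0) (y :: Y) i).1) s
    *: g (take k (perm_list (y :: Y) s)) (drop k (perm_list (y :: Y) s)).
pose G p := \sum_(s : 'S_m | unshuffle k (lift_perm p ord0 s))
  H (lift_perm p ord0 s).
pose f0 A B := if (size A).+1 == k then g (y :: A) B else 0.
pose f1 A B := if size A == k then ksign F y.1 (sdeg A) *: g A (y :: B) else 0.
transitivity (\sum_p G p).
  rewrite (partition_big (fun s : 'S_m.+1 => s^-1%g ord0) predT) //=.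
  apply: eq_bigr => p _; rewrite /G -(reindex_lift_perm p ord0 (unshuffle k) H).
  apply: eq_bigl => s.
  by rewrite -(inj_eq (@perm_inj _ s)) permKV eq_sym.
transitivity (split_sum f0 Y + split_sum f1 Y); last first.
  by congr (_ + _); apply: eq_split_sum => A B _ _; rewrite /f1; case: ifP;
     rewrite ?scaler0.
have G0 (p : 'I_m.+1) : (p != 0%N :> nat) -> (p != k :> nat) -> G p = 0.
  move=> p0 pk; apply: big_pred0 => s; apply/negP => us.
  have := unshuffle_preim0 us (lift_perm_id p ord0 s).
  by rewrite (negPf p0) (negPf pk).
have Gk (p : 'I_m.+1) : p = k :> nat -> G p = split_sum f1 Y.
  move=> pk; have km' : (k <= m)%N by rewrite -pk -ltnS.
  rewrite -IH //; apply: eq_big => [s|s _].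
    apply: unshuffle_lift_perm => [|j]; rewrite ?pk ?eqxx ?orbT //.
    by rewrite -pk lift_ltn.
  rewrite /H koszul_lift_perm perm_list_lift /= pk sdeg_take_perm_list //.
  have sz : size (take k (perm_list Y s)) = k.
    by rewrite size_takel ?size_perm_list.
  by rewrite take_size_cat // drop_size_cat // mulrC -scalerA.
have Gz (k' : nat) : k = k'.+1 -> G ord0 = split_sum f0 Y.
  move=> kk; rewrite /G kk /f0 kk -(IH k') //; last by move: km; rewrite kk.
  apply: eq_big => [s|s _]; first exact: unshuffle_lift_perm.
  rewrite /H koszul_lift_perm perm_list_lift /= take0 drop0 /= big_pred0 //.
  by rewrite ksign0r mul1r kk.
rewrite /m in G0 Gk Gz km *.
rewrite (bigD1 ord0) //=.
(* For [k = 0] the positions 0 and [k] coincide, the first block is empty, and only [f1] remains. *)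
case: k km @H @G @f0 @f1 G0 Gk Gz => [|k] km H G f0 f1 G0 Gk Gz.
  rewrite Gk // big1 => [|p]; last by rewrite -val_eqE => p0; apply: G0.
  rewrite addr0 (eq_split_sum (f := f0) (g := fun _ _ => 0)) //.
  by rewrite split_sum0 add0r.
rewrite (Gz k) //; congr (_ + _).
(* If the first block is the whole list, no position follows it, and [f1] vanishes because [A] would
   be longer than [Y]. *)
move: km; rewrite leq_eqVlt => /orP[/eqP km|km].
  rewrite big1 => [|p p0]; last by apply: G0 => //; rewrite km neq_ltn ltn_ord.
  rewrite (eq_split_sum (g := fun _ _ => 0)) ?split_sum0 // => A B sAB _.
  rewrite /f1; case: eqP => // sA; move: (leq_addr (size B) (size A)).
  by rewrite sAB sA km ltnn.
rewrite (bigD1 (Ordinal km)) ?Gk //= big1 ?addr0 // => p.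
by rewrite -!val_eqE => /andP[]; apply: G0.
Qed.

(** Each splitting is counted for exactly one [k], the length of [A]. *)
Lemma sum_insert_at (K L : seq E -> E) Y :
  \sum_(k < (size Y).+1) insert_at k K L Y
    = split_sum (fun A B => L (K (unzip2 A) :: unzip2 B)) Y.
Proof.
rewrite (eq_bigr (fun k : 'I_(size Y).+1 => split_sum (fun A B =>
    if size A == k then L (K (unzip2 A) :: unzip2 B) else 0) Y)) => [|k _].
  rewrite -split_sum_sum; apply: eq_split_sum => A B sAB _.
  have sA : (size A < (size Y).+1)%N by rewrite ltnS -sAB leq_addr.
  rewrite (bigD1 (Ordinal sA)) //= eqxx big1 ?addr0 // => k.
  by rewrite -val_eqE eq_sym => /negPf /= ->.
rewrite -(sum_unshuffle (fun A B => L (K (unzip2 A) :: unzip2 B)));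
  last by rewrite -ltnS.
apply: eq_bigr => s _; rewrite /= /perm_list; congr (_ *: L (K _ :: _)).
  by rewrite /unzip2 map_take -[in RHS]map_comp.
by rewrite /unzip2 map_drop -[in RHS]map_comp.
Qed.

End Unshuffles.

(** * Multilinear extension from homogeneous vectors *)

Section Expansion.

Variables (F : fieldType) (E : gradedSpace F).
Local Notation hvec := (int * gcarrier E)%type.
Implicit Types (A B Y : seq hvec) (X : seq E).
Implicit Types (K L M : seq E -> E) (G : seq hvec -> E).

Section Multilinear.

Variables (K : seq E -> E) (Kl : multilinear K).

Lemma multilinear0 s t : K (s ++ 0 :: t) = 0.
Proof.
have := Kl s t 1 0 0; rewrite scaler0 addr0 scale1r => /eqP.
by rewrite -subr_eq subrr eq_sym => /eqP.
Qed.

Lemma multilinearZ s t a x : K (s ++ (a *: x) :: t) = a *: K (s ++ x :: t).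
Proof. by have := Kl s t a x 0; rewrite multilinear0 !addr0. Qed.

Lemma multilinearD s t x y :
  K (s ++ (x + y) :: t) = K (s ++ x :: t) + K (s ++ y :: t).
Proof. by have := Kl s t 1 x y; rewrite !scale1r. Qed.

Lemma multilinear_sum s t (I : Type) (r : seq I) (f : I -> E) :
  K (s ++ (\sum_(i <- r) f i) :: t) = \sum_(i <- r) K (s ++ f i :: t).
Proof.
elim: r => [|i r IH]; first by rewrite !big_nil multilinear0.
by rewrite !big_cons multilinearD IH.
Qed.

Lemma multilinear_catl s : multilinear (fun Z => K (s ++ Z)).
Proof. by move=> s' t' a x y; rewrite !catA Kl. Qed.

Lemma multilinear_catr t : multilinear (fun Z => K (Z ++ t)).
Proof. by move=> s' t' a x y; rewrite -!catA Kl. Qed.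

Lemma multilinear_cons x : multilinear (fun Z => K (x :: Z)).
Proof. exact: (multilinear_catl [:: x]). Qed.

End Multilinear.

Lemma homog_gproj i (x : E) : homog i (gproj E i x).
Proof. by rewrite /homog gproj_comp eqxx. Qed.

Lemma homog0 i : homog i (0 : E).
Proof. by rewrite /homog linear0. Qed.

Lemma homogD i (x y : E) : homog i x -> homog i y -> homog i (x + y).
Proof. by rewrite /homog linearD => /eqP -> /eqP ->. Qed.

Lemma homogZ i a (x : E) : homog i x -> homog i (a *: x).
Proof. by rewrite /homog linearZ => /eqP ->. Qed.

Lemma gsupp_uniq (x : E) : uniq (gsupp x).
Proof. by case/andP: (xchooseP (gproj_sum x)). Qed.

Lemma gsupp_sum (x : E) : x = \sum_(i <- gsupp x) gproj E i x.
Proof. by case/andP: (xchooseP (gproj_sum x)) => _ /eqP. Qed.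

Lemma gproj_homog i j (x : E) : homog i x -> j != i -> gproj E j x = 0.
Proof. by move=> /eqP <- /negPf ji; rewrite gproj_comp ji. Qed.

Lemma gproj_notin i (x : E) : i \notin gsupp x -> gproj E i x = 0.
Proof.
move=> ix; rewrite [in LHS](gsupp_sum x) linear_sum big1_seq // => j /= jx.
rewrite gproj_comp; case: eqP => // ij; by rewrite ij jx in ix.
Qed.

(** [gsupp x] is an arbitrarily chosen set containing the support, with no control over how it
    varies with [x]. Since [h i 0 = 0], it may be enlarged to a set shared by several vectors. *)
Lemma sum_gsupp (h : int -> E -> E) (x : E) (r : seq int) :
    (forall i, h i 0 = 0) -> uniq r -> {subset gsupp x <= r} ->
  \sum_(i <- gsupp x) h i (gproj E i x) = \sum_(i <- r) h i (gproj E i x).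
Proof.
move=> h0 ur sr; rewrite [RHS](bigID [in gsupp x]) /= addrC.
rewrite [X in _ = X + _]big1 ?add0r.
  rewrite -[RHS]big_filter; apply/perm_big/uniq_perm;
    rewrite ?filter_uniq ?gsupp_uniq //.
  by move=> i; rewrite mem_filter; case: (boolP (i \in gsupp x)) => //= /sr.
by move=> i ix; rewrite gproj_notin.
Qed.

Lemma sum_gsupp_homog (h : int -> E -> E) i (x : E) :
    (forall j, h j 0 = 0) -> homog i x ->
  \sum_(j <- gsupp x) h j (gproj E j x) = h i x.
Proof.
move=> h0 hx.
(* The degree [i] is added because it may be missing from [gsupp x] when [x = 0]. *)
rewrite (sum_gsupp (r := undup (i :: gsupp x)) h0) ?undup_uniq //; last first.
  by move=> j jx; rewrite mem_undup inE jx orbT.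
rewrite (bigD1_seq i) ?undup_uniq ?mem_undup ?mem_head //= big1 ?addr0.
  by rewrite (eqP hx).
by move=> j ji; rewrite (gproj_homog hx).
Qed.

Lemma sum_gsupp_linear (h : int -> E -> E) a (x y : E) :
    (forall i b u v, h i (b *: u + v) = b *: h i u + h i v) ->
  \sum_(i <- gsupp (a *: x + y)) h i (gproj E i (a *: x + y))
    = a *: (\sum_(i <- gsupp x) h i (gproj E i x))
      + \sum_(i <- gsupp y) h i (gproj E i y).
Proof.
move=> hl; have h0 i : h i 0 = 0.
  by have := hl i (-1) 0 0; rewrite scaler0 addr0 scaleN1r addNr.
pose r := undup (gsupp (a *: x + y) ++ gsupp x ++ gsupp y).
have ur : uniq r := undup_uniq _.
rewrite !(sum_gsupp (r := r)) //; last 3 first.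
- by move=> i; rewrite mem_undup !mem_cat => ri; rewrite ri ?orbT.
- by move=> i; rewrite mem_undup !mem_cat => ri; rewrite ri ?orbT.
- by move=> i; rewrite mem_undup !mem_cat => ri; rewrite ri ?orbT.
rewrite scaler_sumr -big_split; apply: eq_bigr => i _ /=.
by rewrite linearP hl.
Qed.

Lemma big_components_cons G x (X : seq E) :
  \sum_(Y <- components (x :: X)) G Y
    = \sum_(i <- gsupp x) \sum_(Y <- components X) G ((i, gproj E i x) :: Y).
Proof. exact: big_allpairs_dep. Qed.

Lemma componentsP Y (X : seq E) :
  Y \in components X -> homog_list Y /\ size Y = size X.
Proof.
elim: X Y => [|x X IH] Y; first by rewrite inE => /eqP ->.
case/allpairsPdep => i [Y' [ix /IH[hY sY] ->]].
by rewrite /= homog_gproj hY sY.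
Qed.

Lemma multilinear_components K (X : seq E) : multilinear K ->
  K X = \sum_(Y <- components X) K (unzip2 Y).
Proof.
elim: X K => [|x X IH] K Kl; first by rewrite big_seq1.
rewrite big_components_cons [in LHS](gsupp_sum x).
rewrite (multilinear_sum Kl [::]); apply: eq_bigr => i _.
exact: (IH _ (multilinear_cons Kl _)).
Qed.

Lemma eq_multilinear K L : multilinear K -> multilinear L ->
  (forall Y, homog_list Y -> K (unzip2 Y) = L (unzip2 Y)) -> K = L.
Proof.
move=> Kl Ll KL; apply/funext => X.
rewrite (multilinear_components _ Kl) (multilinear_components _ Ll).
by apply: eq_big_seq => Y /componentsP[/KL].
Qed.

(** Graded symmetry allows arbitrary vectors around the exchanged pair; expanding [s] and [t] into
    components makes the whole list homogeneous. *)
Lemma graded_symmetric_homog K : multilinear K ->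
    (forall s t x y, homog_list (s ++ x :: y :: t) ->
      K (unzip2 (s ++ x :: y :: t))
        = ksign F x.1 y.1 *: K (unzip2 (s ++ y :: x :: t))) ->
  graded_symmetric K.
Proof.
move=> Kl Ks s t i j x y hx hy.
have Kst u v : K (s ++ u :: v :: t)
    = \sum_(S <- components s) \sum_(T <- components t)
        K (unzip2 S ++ u :: v :: unzip2 T).
  rewrite (multilinear_components s (multilinear_catr Kl _)).
  apply: eq_bigr => S _.
  rewrite (catA (unzip2 S) [:: u; v]).
  rewrite (multilinear_components t (multilinear_catl Kl _)).
  by apply: eq_bigr => T _; rewrite -catA.
rewrite !Kst scaler_sumr; apply: eq_big_seq => S /componentsP[hS _].
rewrite scaler_sumr; apply: eq_big_seq => T /componentsP[hT _].
have := Ks S T (i, x) (j, y); rewrite /unzip2 !map_cat /=; apply.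
by rewrite /homog_list all_cat /= hx hy; apply/andP.
Qed.

(** The label [i] is held fixed and need not be the degree of the vector beside it, so linearity can
    be stated without homogeneity conditions. *)
Definition labelled_multilinear G := forall s t i a (x y : E),
  G (s ++ (i, a *: x + y) :: t)
    = a *: G (s ++ (i, x) :: t) + G (s ++ (i, y) :: t).

Definition component_sum G : seq E -> E :=
  fun X => \sum_(Y <- components X) G Y.

Lemma component_sum_linear G : labelled_multilinear G ->
  multilinear (component_sum G).
Proof.
rewrite /component_sum => Gl s; elim: s G Gl => [|z s IH] G Gl t a x y.
  rewrite !big_components_cons.
  pose h i v := \sum_(Y <- components t) G ((i, v) :: Y).
  rewrite (sum_gsupp_linear (h := h)) //.
  move=> i b u v; rewrite scaler_sumr -big_split; apply: eq_bigr => Y _.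
  exact: (Gl [::]).
rewrite /= !big_components_cons scaler_sumr -big_split; apply: eq_bigr => i _.
apply: (IH (fun Y => G ((i, gproj E i z) :: Y))) => s' t' j b u v.
exact: (Gl (_ :: s')).
Qed.

Lemma component_sum_homog G Y : labelled_multilinear G -> homog_list Y ->
  component_sum G (unzip2 Y) = G Y.
Proof.
rewrite /component_sum; elim: Y G => [|[i x] Y IH] G Gl.
  by rewrite big_seq1.
case/andP=> /= hx hY; rewrite big_components_cons.
pose h i v := \sum_(T <- components (unzip2 Y)) G ((i, v) :: T).
rewrite (sum_gsupp_homog (h := h) (i := i)) //.
  apply: (IH (fun T => G ((i, x) :: T))) => // s t j b u v.
  exact: (Gl (_ :: s)).
move=> j; rewrite /h big1 // => T _; have := Gl [::] T j (-1) 0 0.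
by rewrite scaler0 addr0 scaleN1r addNr.
Qed.

End Expansion.

(** * Insertion *)

Section Insertion.

Variables (F : fieldType) (E : gradedSpace F).
Local Notation hvec := (int * gcarrier E)%type.
Implicit Types (Y : seq hvec) (X : seq E) (K L M : seq E -> E).

Lemma multilinear_add K L :
  multilinear K -> multilinear L -> multilinear (K + L).
Proof.
by move=> Kl Ll s t a x y; rewrite addrfctE Kl Ll scalerDr addrACA.
Qed.

Lemma multilinear_scale a K : multilinear K -> multilinear (a *: K).
Proof.
move=> Kl s t b x y; rewrite scalrfctE Kl scalerDr !scalerA.
by rewrite mulrC.
Qed.

Definition ins K L Y : E :=
  split_sum (fun A B => L (K (unzip2 A) :: unzip2 B)) Y.

Lemma insertionE K L : insertion K L = component_sum (ins K L).
Proof.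
apply/funext => X; apply: eq_big_seq => Y /componentsP[_ sY].
by rewrite -sY sum_insert_at.
Qed.

Lemma eq_insertion K L K' L' X :
    (forall A B, (size A + size B = size X)%N ->
       L (K A :: B) = L' (K' A :: B)) ->
  insertion K L X = insertion K' L' X.
Proof.
move=> KL; rewrite !insertionE; apply: eq_big_seq => Y /componentsP[_ sY].
by apply: eq_split_sum => A B sAB _; apply: KL; rewrite !size_map sAB.
Qed.

Lemma insertion_eq0 K L X :
    (forall A B, (size A + size B = size X)%N -> L (K A :: B) = 0) ->
  insertion K L X = 0.
Proof.
move=> KL; rewrite insertionE; apply: big1_seq => Y /= /componentsP[_ sY].
rewrite -[RHS](split_sum0 Y); apply: eq_split_sum => A B sAB _.
by apply: KL; rewrite !size_map sAB.
Qed.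

Lemma ins_linear K L : multilinear K -> multilinear L ->
  labelled_multilinear (ins K L).
Proof.
move=> Kl Ll s t i a x y; apply: split_sum_linear => [s' t' B|A s' t'].
  by rewrite /unzip2 !map_cat /= Kl (Ll [::]).
by rewrite /unzip2 !map_cat /= (Ll (_ :: _)).
Qed.

Lemma insertion_multilinear K L : multilinear K -> multilinear L ->
  multilinear (insertion K L).
Proof.
by move=> Kl Ll; rewrite insertionE; apply/component_sum_linear/ins_linear.
Qed.

Lemma insertion_homog K L Y : multilinear K -> multilinear L ->
  homog_list Y -> insertion K L (unzip2 Y) = ins K L Y.
Proof.
move=> Kl Ll hY; rewrite insertionE component_sum_homog //.
exact: ins_linear.
Qed.

Lemma insertion_form K L : vector_form K -> vector_form L ->
  vector_form (insertion K L).
Proof.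
move=> [Kl Ks] [Ll Ls]; have KLl := insertion_multilinear Kl Ll.
split=> //; apply: graded_symmetric_homog => // s t x y hY.
have swapp A B : homog_list (A ++ x :: y :: B) ->
    [/\ homog x.1 x.2, homog y.1 y.2 & homog_list (A ++ y :: x :: B)].
  by rewrite /homog_list !all_cat /= => /and4P[-> -> -> ->].
have [hx hy hY'] := swapp _ _ hY.
rewrite !insertion_homog //; apply: split_sum_swap => [s' t' B|A s' t'].
  rewrite /unzip2 !map_cat /= (Ks _ _ x.1 y.1) //.
  exact: (multilinearZ Ll [::]).
by rewrite /unzip2 !map_cat /= (Ls (_ :: _) _ x.1 y.1).
Qed.

Lemma split_sum_map (g : E -> E) (f : seq hvec -> seq hvec -> E) Y :
    {morph g : x y / x + y} -> (forall a, {morph g : x / a *: x}) ->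
  g (split_sum f Y) = split_sum (fun A B => g (f A B)) Y.
Proof.
move=> gD gZ; elim: Y f => //= y Y IH f; rewrite gD !IH; congr (_ + _).
by apply: eq_split_sum => A B _ _; rewrite gZ.
Qed.

Lemma homog_split_sum i (f : seq hvec -> seq hvec -> E) Y : homog_list Y ->
    (forall A B, homog_list A -> homog_list B -> sdeg A + sdeg B = sdeg Y ->
      homog i (f A B)) ->
  homog i (split_sum f Y).
Proof.
move=> hY hf; apply/eqP.
rewrite split_sum_map; [|exact: linearD|by move=> a x; rewrite linearZ].
apply: (eq_split_sum_all hY) => A B hA hB _ dAB.
by apply/eqP/hf.
Qed.

Lemma insertion_degree d e K L : multilinear K -> multilinear L ->
  of_degree d K -> of_degree e L -> of_degree (d + e) (insertion K L).
Proof.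
move=> Kl Ll Kd Le Y hY; rewrite insertion_homog //.
apply: homog_split_sum => // A B hA hB dAB.
(* The value of [K] on [A] is homogeneous of degree [sdeg A + d], so with this label it heads a
   homogeneous list. *)
have := Le ((sdeg A + d, K (unzip2 A)) :: B).
rewrite /homog_list /= Kd // big_cons /= => /(_ hB).
by rewrite -[\sum_(y <- Y) y.1]/(sdeg Y) -dAB -/(sdeg B) addrACA addrA.
Qed.

Lemma insertionDr K L M : insertion K (L + M) = insertion K L + insertion K M.
Proof.
apply/funext => X; rewrite !insertionE -[RHS]big_split; apply: eq_bigr => Y _.
by rewrite /= /ins -split_sumD.
Qed.

Lemma insertionZr a K L : insertion K (a *: L) = a *: insertion K L.
Proof.
apply/funext => X; rewrite !insertionE -[RHS]/(a *: component_sum _ X).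
rewrite scaler_sumr; apply: eq_bigr => Y _.
by rewrite /= /ins -split_sumZ.
Qed.

Lemma insertionDl K L M : multilinear M ->
  insertion (K + L) M = insertion K M + insertion L M.
Proof.
move=> Ml; apply/funext => X; rewrite !insertionE -[RHS]big_split.
apply: eq_bigr => Y _; rewrite /= /ins -split_sumD.
apply: eq_split_sum => A B _ _.
exact: (multilinearD Ml [::]).
Qed.

Lemma insertionZl a K M : multilinear M ->
  insertion (a *: K) M = a *: insertion K M.
Proof.
move=> Ml; apply/funext => X; rewrite !insertionE.
rewrite -[RHS]/(a *: component_sum _ X) scaler_sumr; apply: eq_bigr => Y _.
rewrite /= /ins -split_sumZ; apply: eq_split_sum => A B _ _.
exact: (multilinearZ Ml [::]).
Qed.

Lemma insertion0r K : insertion K 0 = 0.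
Proof. by rewrite -[0 in LHS](scale0r 0) insertionZr scale0r. Qed.

Lemma insertion0l M : multilinear M -> insertion 0 M = 0.
Proof. by move=> Ml; rewrite -[0 in LHS](scale0r 0) insertionZl // scale0r. Qed.

Lemma insertionBr K L M : insertion K (L - M) = insertion K L - insertion K M.
Proof. by rewrite -!scaleN1r insertionDr insertionZr. Qed.

Lemma insertionBl K L M : multilinear M ->
  insertion (K - L) M = insertion K M - insertion L M.
Proof. by move=> Ml; rewrite -!scaleN1r insertionDl // insertionZl. Qed.

(* Pre-Lie identity: the associator only retains the summands *)
(* [C (B Q) (A P) R] in which A and B act on disjoint arguments. *)
Lemma insertion_associator dA dB (A B C : seq E -> E) :
    vector_form A -> of_degree dA A -> vector_form B -> of_degree dB B ->
    vector_form C ->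
  insertion A (insertion B C) - insertion (insertion A B) C
    = (-1) ^ (dA * dB)
        *: (insertion B (insertion A C) - insertion (insertion B A) C).
Proof.
pose h d (K L M : seq E -> E) (P Q R : seq hvec) :=
  ksign F (sdeg P + d) (sdeg Q)
    *: M (L (unzip2 Q) :: K (unzip2 P) :: unzip2 R).
have assocE d (K L M : seq E -> E) Y : multilinear K -> of_degree d K ->
    multilinear L -> multilinear M -> homog_list Y ->
    (insertion K (insertion L M) - insertion (insertion K L) M) (unzip2 Y)
    = split_sum (fun P R => split_sum (fun Q1 Q2 => h d K L M P Q1 Q2) R) Y.
  move=> Kl Kd Ll Ml hY.
  have KLl := insertion_multilinear Kl Ll.
  have LMl := insertion_multilinear Ll Ml.
  rewrite [LHS]/(_ - _) /= !insertion_homog //.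
  apply/eqP; rewrite subr_eq addrC; apply/eqP.
  have -> : ins (insertion K L) M Y
      = split_sum (fun P R => split_sum (fun Q S =>
          M (L (K (unzip2 Q) :: unzip2 S) :: unzip2 R)) P) Y.
    apply: (eq_split_sum_all hY) => P R hP _ _ _; rewrite insertion_homog //.
    rewrite (@split_sum_map (fun v => M (v :: unzip2 R))) // => [u v|a u].
      exact: (multilinearD Ml [::]).
    exact: (multilinearZ Ml [::]).
  rewrite split_sum_coassoc -split_sumD.
  apply: (eq_split_sum_all hY) => P R hP hR _ _.
  (* The value of [K] on [P] heads the list handed to the insertion of [L] into [M]. Inside the
     block of [L] it gives the composite insertion; outside, it passes that block and gives [h],
     with the sign of this passage. *)
  have := @insertion_homog L M ((sdeg P + d, K (unzip2 P)) :: R).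
  rewrite /= Kd // => -> //.
move=> [Al As] Ad [Bl Bs] Bd [Cl Cs].
have ABC : multilinear
    (insertion A (insertion B C) - insertion (insertion A B) C).
  rewrite -scaleN1r; apply/multilinear_add/multilinear_scale;
    by do !apply: insertion_multilinear.
pose BAC := insertion B (insertion A C) - insertion (insertion B A) C.
have BACl : multilinear ((-1) ^ (dA * dB) *: BAC).
  rewrite /BAC -scaleN1r; apply: multilinear_scale.
  apply/multilinear_add/multilinear_scale;
    by do !apply: insertion_multilinear.
apply: (eq_multilinear ABC BACl) => Y hY; rewrite (assocE dA) //.
rewrite -[RHS]/(_ *: BAC (unzip2 Y)).
rewrite /BAC (assocE dB) // -!split_sum_coassoc -split_sumZ.
apply: (eq_split_sum_all hY) => P R hP _ _ _.
(* [P] holds the arguments of both [A] and [B]. Cocommutativity exchanges their blocks; the symmetry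
   of [C] then exchanges the two values. *)
rewrite split_sum_cocomm -split_sumZ.
apply: (eq_split_sum_all hP) => Q S hQ hS _ _.
rewrite /h (Cs [::] _ (sdeg Q + dB) (sdeg S + dA)) ?Ad ?Bd //.
rewrite !scalerA; congr (_ *: _).
rewrite -!/(ksign F _ _) !(ksignDl, ksignDr).
rewrite (ksignC F (sdeg S)) (ksignC F dA (sdeg Q)) (ksignC F dB dA).
set a := ksign F (sdeg Q) (sdeg S); set b := ksign F (sdeg Q) dA.
set c := ksign F dB (sdeg S); set e := ksign F dA dB.
transitivity (a * a * (b * b) * (e * (a * c))); first by ring.
by rewrite !ksignK !mul1r.
Qed.

End Insertion.

(** * The Richardson-Nijenhuis bracket *)

Section Bracket.

Variables (F : fieldType) (E : gradedSpace F).
Local Notation hvec := (int * gcarrier E)%type.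
Implicit Types (Y : seq hvec) (X : seq E) (K L M N : seq E -> E).

Lemma vector_formD K L : vector_form K -> vector_form L -> vector_form (K + L).
Proof.
move=> [Kl Ks] [Ll Ls]; split; first exact: multilinear_add.
move=> s t i j x y hx hy.
by rewrite addrfctE (Ks s t i j) // (Ls s t i j) // scalerDr.
Qed.

Lemma vector_formZ a K : vector_form K -> vector_form (a *: K).
Proof.
move=> [Kl Ks]; split; first exact: multilinear_scale.
move=> s t i j x y hx hy.
by rewrite scalrfctE (Ks s t i j) // !scalerA mulrC.
Qed.

Lemma of_degreeD d K L : of_degree d K -> of_degree d L -> of_degree d (K + L).
Proof. by move=> Kd Ld Y hY; apply: homogD; [apply: Kd|apply: Ld]. Qed.

Lemma of_degreeZ d a K : of_degree d K -> of_degree d (a *: K).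
Proof. by move=> Kd Y hY; apply: homogZ; apply: Kd. Qed.

Lemma degree_form_sum d (I : Type) (r : seq I) (f : I -> seq E -> E) :
    (forall i, vector_form (f i) /\ of_degree d (f i)) ->
  vector_form (\sum_(i <- r) f i) /\ of_degree d (\sum_(i <- r) f i).
Proof.
move=> fP; elim/big_ind: _ => //; last first.
  move=> K L [Kf Kd] [Lf Ld]; split; [exact: vector_formD|exact: of_degreeD].
split; first split.
- by move=> s t a x y; rewrite scaler0 addr0.
- by move=> s t i j x y _ _; rewrite scaler0.
- by move=> Y _; apply: homog0.
Qed.

Lemma rn_bracket0E d N L : rn_bracket 0 d N L = insertion N L - insertion L N.
Proof. by rewrite /rn_bracket mul0r expr0z scale1r. Qed.

Lemma rn_bracketDl d N M L : multilinear L ->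
  rn_bracket 0 d (N + M) L = rn_bracket 0 d N L + rn_bracket 0 d M L.
Proof.
by move=> Ll; rewrite !rn_bracket0E insertionDl // insertionDr opprD addrACA.
Qed.

Lemma rn_bracketZl d a N L : multilinear L ->
  rn_bracket 0 d (a *: N) L = a *: rn_bracket 0 d N L.
Proof.
by move=> Ll; rewrite !rn_bracket0E insertionZl // insertionZr scalerBr.
Qed.

Lemma rn_bracketDr d N K L : multilinear N ->
  rn_bracket 0 d N (K + L) = rn_bracket 0 d N K + rn_bracket 0 d N L.
Proof.
by move=> Nl; rewrite !rn_bracket0E insertionDl // insertionDr opprD addrACA.
Qed.

Lemma rn_bracketZr d a N L : multilinear N ->
  rn_bracket 0 d N (a *: L) = a *: rn_bracket 0 d N L.
Proof.
by move=> Nl; rewrite !rn_bracket0E insertionZl // insertionZr scalerBr.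
Qed.

Lemma rn_bracket_suml d (I : Type) (r : seq I) (f : I -> seq E -> E) L :
    multilinear L ->
  rn_bracket 0 d (\sum_(i <- r) f i) L = \sum_(i <- r) rn_bracket 0 d (f i) L.
Proof.
move=> Ll; elim: r => [|i r IH].
  rewrite !big_nil -[X in rn_bracket 0 d X](scale0r 0).
  by rewrite rn_bracketZl // scale0r.
by rewrite !big_cons rn_bracketDl // IH.
Qed.

Lemma rn_bracket0_form d N L : vector_form N -> vector_form L ->
    of_degree 0 N -> of_degree d L ->
  vector_form (rn_bracket 0 d N L) /\ of_degree d (rn_bracket 0 d N L).
Proof.
move=> Nf Lf Nd Ld; rewrite rn_bracket0E -scaleN1r; split.
  by apply/vector_formD/vector_formZ; apply: insertion_form.
have [[Nl _] [Ll _]] := (Nf, Lf).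
apply/of_degreeD/of_degreeZ.
  by rewrite -[d]add0r; apply: insertion_degree.
by rewrite -[d]addr0; apply: insertion_degree.
Qed.

(** * The Euler map *)

Local Arguments euler : simpl never.

Lemma euler_homog i (x : E) : homog i x -> euler E [:: x] = (- i)%:~R *: x.
Proof.
move=> hx; apply: (sum_gsupp_homog (h := fun j v => (- j)%:~R *: v)) => // j.
exact: scaler0.
Qed.

Lemma euler_eq0 X : size X != 1 -> euler E X = 0.
Proof. by case: X => [|x [|y X]]. Qed.

Lemma euler_form : vector_form (euler E).
Proof.
split=> [s t a x y|s t i j x y _ _]; last first.
  by rewrite !euler_eq0 ?scaler0 // size_cat /= !addnS.
case: s => [|z s]; last first.
  by rewrite !euler_eq0 ?scaler0 ?addr0 // size_cat /= !addnS.
case: t => [|z t]; last by rewrite !euler_eq0 ?scaler0 ?addr0.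
apply: (sum_gsupp_linear (h := fun j v => (- j)%:~R *: v)) => i b u v.
by rewrite scalerDr !scalerA mulrC.
Qed.

Lemma euler_degree : of_degree 0 (euler E).
Proof.
case=> [|[i x] [|z Y]] hY; [exact: homog0| |exact: homog0].
case/andP: hY => hx _.
rewrite big_seq1 addr0 -[unzip2 _]/[:: x] (euler_homog hx).
exact: homogZ.
Qed.

(** Each argument in turn is multiplied by minus its degree, and moving it back to its place cancels
    the Koszul sign. The induction freezes the first argument of [K], which leaves a form in the
    others. *)
Lemma insertion_euler K Y : vector_form K -> homog_list Y ->
  insertion (euler E) K (unzip2 Y) = (- sdeg Y)%:~R *: K (unzip2 Y).
Proof.
have [El _] := euler_form.
move=> [Kl Ks] hY; rewrite insertion_homog //.
elim: Y K Kl Ks hY => [|y Y IH] K Kl Ks.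
  by rewrite /ins /= euler_eq0 // sdeg_nil oppr0 scale0r (multilinear0 Kl [::]).
(* When the head enters the left factor, nothing can join it there, [euler] being unary. *)
case/andP=> hy hY; rewrite /ins /= split_sum_left_nil => [|A B]; last first.
  case: A => // a A _; rewrite euler_eq0 //; exact: (multilinear0 Kl [::]).
rewrite (euler_homog hy) (multilinearZ Kl [::]).
rewrite sdeg_cons opprD intrD scalerDl; congr (_ + _).
have Kyl := multilinear_cons Kl y.2.
have Kys : graded_symmetric (fun Z => K (y.2 :: Z)).
  by move=> s t i j u v hu hv; rewrite -!cat_cons (Ks _ _ i j).
rewrite -(IH _ Kyl Kys hY); apply: (eq_split_sum_all hY).
move=> A B hA hB _ _; case: (eqVneq (size A) 1) => sA; last first.
  rewrite !euler_eq0 ?size_map // (multilinear0 Kl [::]).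
  by rewrite (multilinear0 Kl [:: _]) scaler0.
case: A sA hA => [|[i a] [|a' A]] // _ hA.
case/andP: hA => /= ha _; rewrite sdeg_cons sdeg_nil addr0 (euler_homog ha).
rewrite (Ks [::] _ i y.1) // ?homogZ // scalerA -/(ksign F _ _) ksignC.
by rewrite ksignK scale1r.
Qed.

Lemma insertion_into_euler d K Y : multilinear K -> of_degree d K ->
    homog_list Y ->
  insertion K (euler E) (unzip2 Y) = (- (sdeg Y + d))%:~R *: K (unzip2 Y).
Proof.
have [El _] := euler_form.
move=> Kl Kd hY; rewrite insertion_homog // /ins split_sum_right_nil.
  by rewrite (euler_homog (Kd _ hY)).
by move=> A [|b B] // _; rewrite euler_eq0.
Qed.

(** The degrees of the arguments cancel between the two insertions, and only the degree of [K]
    remains. *)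
Lemma rn_bracket_euler d K : vector_form K -> of_degree d K ->
  rn_bracket 0 d (euler E) K = d%:~R *: K.
Proof.
move=> Kf Kd; have [Kl _] := Kf.
have [[/= Bl _] _] := rn_bracket0_form euler_form Kf euler_degree Kd.
apply: (eq_multilinear Bl (multilinear_scale _ Kl)) => Y hY.
rewrite rn_bracket0E -[LHS]/(insertion _ _ _ - insertion _ _ _).
rewrite insertion_euler // (insertion_into_euler Kl Kd) // -scalerBl -intrB.
by rewrite opprK addrA addNr add0r.
Qed.

Lemma rn_bracket_eulerr K : vector_form K -> of_degree 0 K ->
  rn_bracket 0 0 K (euler E) = 0.
Proof.
move=> Kf Kd; have := rn_bracket_euler Kf Kd.
by rewrite !rn_bracket0E scale0r => /eqP; rewrite -oppr_eq0 opprB => /eqP.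
Qed.

(** * Arity bounds and vanishing for degree reasons *)

Definition arity_ge p K := forall X, (size X < p)%N -> K X = 0.

Lemma insertion_arity_ge p q K L : multilinear L ->
    arity_ge p K -> arity_ge q L ->
  arity_ge (p + q).-1 (insertion K L).
Proof.
move=> Ll Kp Lq X sX; apply: insertion_eq0 => A B sAB.
case: (ltnP (size A) p) => sA; first by rewrite Kp // (multilinear0 Ll [::]).
apply: Lq; rewrite /= -(ltn_add2l p); move: sX; rewrite -sAB ltn_predRL.
by apply: leq_trans; rewrite addnS !ltnS leq_add2r.
Qed.

(** [K] consumes exactly [k] arguments, so the length of [X] fixes the arity at which [L] is
    evaluated. The test is additive to avoid truncated subtraction. *)
Lemma insertion_arity_part k m K L X : multilinear L ->
    (forall Z, size Z != k -> K Z = 0) ->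
  insertion K (arity_part m L) X
    = if (size X).+1 == (k + m)%N then insertion K L X else 0.
Proof.
move=> Ll Kk; case: eqP => sX.
  apply: eq_insertion => A B sAB; rewrite /arity_part.
  case: (eqVneq (size A) k) => sA; last first.
    by rewrite Kk // (multilinear0 Ll [::]) if_same.
  by move/eqP: sX; rewrite -sAB sA -addnS eqn_add2l /= => ->.
apply: insertion_eq0 => A B sAB; rewrite /arity_part.
case: (eqVneq (size A) k) => sA; last first.
  by rewrite Kk // (multilinear0 Ll [::]) if_same.
by move/eqP: sX; rewrite -sAB sA -addnS eqn_add2l /= => /negPf ->.
Qed.

Lemma insertion_arity_part_l k m K L X : multilinear K ->
    (forall Z, size Z != k -> K Z = 0) ->
  insertion (arity_part m L) K X
    = if (size X).+1 == (k + m)%N then insertion L K X else 0.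
Proof.
move=> Kl Kk; case: eqP => sX.
  apply: eq_insertion => A B sAB; rewrite /arity_part.
  case: (eqVneq (size B).+1 k) => sB; last by rewrite !Kk.
  by move/eqP: sX; rewrite -sAB -sB -addnS addnC eqn_add2l /= => ->.
apply: insertion_eq0 => A B sAB; rewrite /arity_part.
case: (eqVneq (size B).+1 k) => sB; last by rewrite !Kk.
move/eqP: sX; rewrite -sAB -sB -addnS addnC eqn_add2l /= => /negPf ->.
exact: (multilinear0 Kl [::]).
Qed.

Lemma sdeg_le_size n Y K : concentrated E (- n%:Z) (- 1) -> multilinear K ->
  homog_list Y -> K (unzip2 Y) != 0 -> sdeg Y <= - (size Y)%:Z.
Proof.
move=> En; elim: Y K => [|y Y IH] K Kl; first by rewrite sdeg_nil.
case/andP=> hy hY KY.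
have y0 : y.2 != 0.
  by apply: contraNneq KY => /= ->; rewrite (multilinear0 Kl [::]).
have /andP[_ y1] := En _ _ hy y0.
rewrite sdeg_cons /= -add1n PoszD opprD lerD //.
exact: (IH _ (multilinear_cons Kl y.2)).
Qed.

(** A nonzero value has degree at least -n. Its arguments are then nonzero, each of degree at most
    -1, so the value has degree at most [d] minus their number. *)
Lemma form_eq0 n d K X : concentrated E (- n%:Z) (- 1) -> multilinear K ->
  of_degree d%:Z K -> (n + d < size X)%N -> K X = 0.
Proof.
move=> En Kl Kd sX; rewrite (multilinear_components _ Kl).
apply: big1_seq => Y /= /componentsP[hY sY]; apply/eqP.
apply: contraLR sX => KY.
have Yle := sdeg_le_size En Kl hY KY.
have /andP[nY _] := En _ _ (Kd _ hY) KY.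
rewrite -leqNgt -sY -lez_nat PoszD -lerBlDr -[_ - _]opprK lerNl opprB.
by apply: (le_trans nY); rewrite -/(sdeg Y) addrC lerD2l.
Qed.

(** * Squares of deformed brackets *)

Variable two_neq0 : 2%:R != 0 :> F.

Lemma mul2_eq0 K : K + K = 0 -> K = 0.
Proof.
move=> KK; apply: (scalerI two_neq0).
by rewrite scaler0 -[2%:R]/(1 + 1) scalerDl scale1r.
Qed.

Section Deformation.

Variables (mu : seq E -> E) (muf : vector_form mu) (mud : of_degree 1 mu).
Hypothesis mu2 : insertion mu mu = 0.

(* 2 [mu, [mu, N]] = [[mu, mu], N] by the Jacobi identity; [mu, nu] appears *)
(* unfolded, with a plus sign as both forms have degree 1. *)
Lemma bracket_deformed0 N : vector_form N -> of_degree 0 N ->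
  insertion mu (rn_bracket 0 1 N mu) + insertion (rn_bracket 0 1 N mu) mu = 0.
Proof.
move=> Nf Nd; have [[mul _] [Nl _]] := (muf, Nf).
have as1 := insertion_associator muf mud Nf Nd muf.
have as2 := insertion_associator muf mud muf mud Nf.
rewrite mu2 insertion0r mulr0 expr0z scale1r sub0r in as1.
rewrite mu2 insertion0l // subr0 mulr1 expr1z scaleN1r in as2.
(* With [mu] of odd degree in both places, the pre-Lie identity equates this term with its own
   negative. *)
have {}as2 : insertion mu (insertion mu N) = 0.
  by apply: mul2_eq0; rewrite {1}as2 addNr.
rewrite rn_bracket0E insertionBr insertionBl //.
rewrite as2 subr0 addrA [_ + _ in LHS]addrAC as1.
by rewrite addNr.
Qed.

Lemma deformed_square0 N K : nijenhuis mu N K ->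
  insertion (rn_bracket 0 1 N mu) (rn_bracket 0 1 N mu) = 0.
Proof.
case=> -[Nf Nd] [Kf Kd] NNmu _.
have JN := bracket_deformed0 Nf Nd.
have JK := bracket_deformed0 Kf Kd.
have [nuf nud] := rn_bracket0_form Nf muf Nd mud.
have [[mul _] [Nl _] [nul _]] := And3 muf Nf nuf.
(* The square condition turns [mu, [K, mu]] = 0 into [mu, [N, nu]] = 0. *)
rewrite -NNmu in JK.
(* The Jacobi identity for [mu], [N], [nu] is spread over three pre-Lie identities, each of the
   three forms being once the outermost. *)
have as1 := insertion_associator muf mud Nf Nd nuf.
have as2 := insertion_associator muf mud nuf nud Nf.
have as3 := insertion_associator Nf Nd nuf nud muf.
rewrite mulr0 expr0z scale1r in as1.
rewrite mulr1 expr1z scaleN1r in as2.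
rewrite mul0r expr0z scale1r in as3.
move: JN JK nuf nud nul as1 as2 as3 {NNmu}.
rewrite [rn_bracket 0 1 N (rn_bracket _ _ _ _)]rn_bracket0E.
have nuE := rn_bracket0E 1 N mu.
set nu := rn_bracket 0 1 N mu in nuE *.
move=> JN JK nuf nud nul as1 as2 as3.
(* [nu, nu] is twice this insertion. One factor is expanded as [N, mu]: the inserted one here, the
   receiving one in [nunu']. *)
have nunu : insertion nu nu
    = insertion (insertion N mu) nu - insertion (insertion mu N) nu.
  by rewrite -insertionBl // -nuE.
have nunu' : insertion nu nu
    = insertion nu (insertion N mu) - insertion nu (insertion mu N).
  by rewrite -insertionBr // -nuE.
have NJ : insertion N (insertion mu nu) + insertion N (insertion nu mu) = 0.
  by rewrite -insertionDr JN insertion0r.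
have JN' : insertion (insertion mu nu) N + insertion (insertion nu mu) N = 0.
  by rewrite -insertionDl // JN insertion0l.
apply: mul2_eq0.
have e1 : insertion mu (insertion N nu)
    = insertion N (insertion mu nu) - insertion nu nu.
  move/eqP: as1; rewrite subr_eq => /eqP ->.
  by rewrite nunu opprB [in RHS]addrA addrAC.
have e2 : insertion mu (insertion nu N) = - insertion nu (insertion mu N).
  move/eqP: as2; rewrite subr_eq => /eqP ->.
  by rewrite opprB addrAC [_ + insertion _ N]addrC JN' sub0r.
have e3 : insertion (insertion N nu) mu - insertion (insertion nu N) mu
    = insertion N (insertion nu mu) - insertion nu (insertion N mu).
  move/eqP: as3; rewrite subr_eq => /eqP ->.
  by rewrite [X in _ = X - _]addrC -addrA [X in _ = _ + X]addrAC subrr sub0r.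
move: JK; rewrite insertionBr insertionBl // e1 e2 e3 opprK addrACA.
rewrite [X in X + _]addrAC NJ sub0r -[X in _ + X]opprB -nunu' -opprD => /eqP.
by rewrite oppr_eq0 => /eqP.
Qed.

End Deformation.
End Bracket.

(** * Lie n-algebras *)

Section LieNAlgebra.

Variables (F : fieldType) (n : nat) (E : gradedSpace F) (mu : seq E -> E).
Hypothesis hmu : lie_n_algebra n mu.

Let En : concentrated E (- n%:Z) (- 1).
Proof. by case: hmu. Qed.

Let muf : vector_form mu.
Proof. by case: hmu => _ []. Qed.

Let mud : of_degree 1 mu.
Proof. by case: hmu => _ []. Qed.

Let mu_nil : mu [::] = 0.
Proof. by case: hmu => _ []. Qed.

Let mul : multilinear mu.
Proof. by case: muf. Qed.

(** The L-infinity axiom starts at [i = 1], whereas insertion also has a term for [k = 0], in which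
    [K [::]] is inserted. *)
Lemma sum_insert_at_gt0 (K L : seq E -> E) (Y : seq (int * E)) :
    K [::] = 0 -> multilinear L ->
  \sum_(1 <= i < (size Y).+1) insert_at i K L Y = ins K L Y.
Proof.
move=> K0 Ll; rewrite -[RHS](sum_insert_at K L Y).
rewrite big_ord_recl big_add1 /= big_mkord.
rewrite [X in _ = X + _]big1 ?add0r // => s _.
by rewrite /= take0 K0 (multilinear0 Ll [::]) scaler0.
Qed.

Lemma lie_n_algebra_square0 : insertion mu mu = 0.
Proof.
case: hmu => _ [_ _ _ mu2].
apply: (eq_multilinear (insertion_multilinear mul mul)) => [s t a x y|Y hY].
  by rewrite scaler0 addr0.
(* The axiom speaks of nonempty lists; the empty one is settled by [mu_nil]. *)
rewrite insertion_homog //; case: (posnP (size Y)) => sY; last first.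
  by rewrite -sum_insert_at_gt0 // mu2.
by rewrite (size0nil sY) /ins /= mu_nil (multilinear0 mul [::]).
Qed.

(** * Adding forms of high arity to the Euler map *)

Section HighArity.

Variables (M : seq E -> E) (p : nat).
Hypotheses (Mf : vector_form M) (Md : of_degree 0 M).
Hypotheses (Mp : arity_ge p M) (hp : (n + 3 <= 2 * p)%N).

Let Ml : multilinear M.
Proof. by case: Mf. Qed.

Let mu1 : arity_ge 1 mu.
Proof. by case. Qed.

Lemma form_arity_eq0 (K : seq E -> E) (d q : nat) :
    multilinear K -> of_degree d%:Z K -> arity_ge q K -> (n + d < q)%N ->
  K = 0.
Proof.
move=> Kl Kd Kq ndq; apply/funext => X; case: (ltnP (size X) q) => [/Kq //|qX].
by apply: (form_eq0 En Kl Kd); apply: leq_trans qX.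
Qed.

Lemma arity_geB q (K L : seq E -> E) :
  arity_ge q K -> arity_ge q L -> arity_ge q (K - L).
Proof. by move=> Kq Lq X qX; rewrite addrfctE opprfctE Kq // Lq // subr0. Qed.

Lemma rn_bracket_high_arity (L : seq E -> E) (q d : nat) :
  multilinear L -> arity_ge q L -> arity_ge (p + q).-1 (rn_bracket 0 d M L).
Proof.
move=> Ll Lq; rewrite rn_bracket0E; apply: arity_geB.
  exact: insertion_arity_ge.
by rewrite addnC; apply: insertion_arity_ge.
Qed.

Lemma rn_bracket_high2 : rn_bracket 0 1 M (rn_bracket 0 1 M mu) = 0.
Proof.
have [Bf Bd] := rn_bracket0_form Mf muf Md mud.
have [[/= BBl _] BBd] := rn_bracket0_form Mf Bf Md Bd.
have Ba := rn_bracket_high_arity 1 mul mu1.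
have BBa := rn_bracket_high_arity 1 (proj1 Bf) Ba.
apply: (form_arity_eq0 BBl BBd BBa); lia.
Qed.

Let S := euler E.

Let Sf : vector_form S := euler_form E.
Let Sd : of_degree 0 S := @euler_degree _ E.

(** The scalar is 1 for the deformed bracket and 2 for the bracket with the square. *)
Lemma rn_bracket_euler_add a :
  rn_bracket 0 1 (S + a *: M) mu = mu + a *: rn_bracket 0 1 M mu.
Proof.
by rewrite rn_bracketDl // rn_bracketZl // (rn_bracket_euler muf mud) scale1r.
Qed.

Lemma nijenhuis_euler_add : nijenhuis mu (S + M) (S + 2 *: M).
Proof.
have Af : vector_form (S + M) by apply: vector_formD.
have Bf : vector_form (S + 2 *: M) by apply/vector_formD/vector_formZ.
have [Nf Nd] := rn_bracket0_form Mf muf Md mud.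
have M2d : of_degree 0 (S + 2 *: M) by apply/of_degreeD/of_degreeZ.
split.
- by split=> //; apply: of_degreeD.
- by [].
- have SM : rn_bracket 0 1 (S + M) mu = mu + rn_bracket 0 1 M mu.
    by rewrite -[M in LHS]scale1r rn_bracket_euler_add scale1r.
  rewrite rn_bracket_euler_add SM rn_bracketDr; last by case: Af.
  rewrite SM rn_bracketDl; last by case: Nf.
  rewrite rn_bracket_high2 addr0 (rn_bracket_euler Nf Nd) scale1r.
  by rewrite -addrA -[2]/(1 + 1) scalerDl scale1r.
(* Brackets of [S] with forms of degree zero vanish, and [M, M] is a commutator of [M] with
   itself. *)
rewrite rn_bracketDl; last by case: Bf.
rewrite (rn_bracket_euler Bf M2d) scale0r add0r rn_bracketDr //.
rewrite rn_bracketZr // (rn_bracket0E 0 M M) subrr scaler0 addr0.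
exact: rn_bracket_eulerr.
Qed.

Lemma lie_n_algebra_deformed : 2%:R != 0 :> F ->
  lie_n_algebra n (rn_bracket 0 1 (S + M) mu).
Proof.
move=> two_neq0.
have Mnil : M [::] = 0 by apply: Mp => /=; lia.
have Nij := nijenhuis_euler_add.
have nu2 := deformed_square0 two_neq0 muf mud lie_n_algebra_square0 Nij.
have [[Nf Nd] _ _ _] := Nij.
have [nuf nud] := rn_bracket0_form Nf muf Nd mud.
have [nul _] := nuf.
have nu_nil : rn_bracket 0 1 (S + M) mu [::] = 0.
  have aN : arity_ge 1 (S + M).
    by case=> // _; rewrite addrfctE Mnil /S /euler addr0.
  rewrite rn_bracket0E addrfctE opprfctE.
  have [Nl _] := Nf.
  by rewrite !(insertion_arity_ge (p := 1) (q := 1)) // subr0.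
split=> //; split=> // Y hY _.
by rewrite sum_insert_at_gt0 // -insertion_homog // nu2.
Qed.

End HighArity.

Lemma rn_bracket_arity_part k m (N : seq E -> E) X : vector_kform k N ->
  rn_bracket 0 1 N (arity_part m mu) X
    = if (size X).+1 == (k + m)%N then rn_bracket 0 1 N mu X else 0.
Proof.
move=> [[Nl _] Nk]; rewrite !rn_bracket0E !addrfctE opprfctE.
rewrite (insertion_arity_part _ _ mul Nk) (insertion_arity_part_l _ _ _ Nl Nk).
by case: ifP; rewrite ?subr0.
Qed.

Lemma rn_bracket_arity_sum k (N : seq E -> E) :
    vector_kform k N -> of_degree 0 N ->
  rn_bracket 0 1 N mu
    = \sum_(1 <= m < (n + 2 - k).+1) rn_bracket 0 1 N (arity_part m mu).
Proof.
move=> Nk Nd; apply/funext => X; rewrite fct_sumE.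
rewrite (eq_bigr _ (fun m _ => rn_bracket_arity_part m X Nk)).
have [Nf N0] := Nk.
have [[Bl _] Bd] := rn_bracket0_form Nf muf Nd mud.
(* At [X] only [m = size X + 1 - k] can contribute. Below the range, [size X < k] and the bracket
   has too few arguments; above it, [size X > n + 1] and the bracket vanishes by degree. *)
case: (boolP (((size X).+1 - k)%N \in index_iota 1 (n + 2 - k).+1)) => [Xm|Xm].
  rewrite (bigD1_seq _ Xm) ?iota_uniq //= big1 ?addr0.
    move: Xm; rewrite mem_index_iota => Xm.
    by case: eqP => //; lia.
  by move=> m mX; case: eqP => // sX; case/eqP: mX; rewrite sX addKn.
rewrite big1_seq => [|m /andP[_ mI]]; last first.
  by case: eqP => // sX; rewrite sX addKn mI in Xm.
case: (leqP (size X).+1 k) => sX.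
  have Na : arity_ge k N by move=> Z Zk; apply: N0; rewrite neq_ltn Zk.
  have mu1 : arity_ge 1 mu by case.
  by apply: (rn_bracket_high_arity Nf Na 1 mul mu1); rewrite addn1.
apply: (form_eq0 En Bl Bd); move: Xm; rewrite mem_index_iota; lia.
Qed.

End LieNAlgebra.

Theorem proposition3p3 (R : realType) (b : base_field)
    (n : nat) (E : gradedSpace (scalars R b)) (mu : seq E -> E)
    (hmu : lie_n_algebra n mu)
    (r : nat) (k : 'I_r -> nat) (N : 'I_r -> seq E -> E)
    (hN : forall i, vector_kform (k i) (N i) /\ of_degree 0 (N i))
    (hk_lo : forall i, (n + 3 <= 2 * k i)%N)
    (hk_mono : forall i j : 'I_r, (i <= j)%N -> (k i <= k j)%N)
    (hk_hi : forall i, (k i <= n + 1)%N) :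
  [/\ nijenhuis mu (euler E + \sum_(i < r) N i)
        (euler E + 2 *: \sum_(i < r) N i),
      lie_n_algebra n (rn_bracket 0 1 (euler E + \sum_(i < r) N i) mu)
    & rn_bracket 0 1 (euler E + \sum_(i < r) N i) mu
      = mu + \sum_(i < r) \sum_(1 <= m < (n + 2 - k i).+1)
               rn_bracket 0 1 (N i) (arity_part m mu)].
Proof.
have two_neq0 : 2%:R != 0 :> scalars R b by rewrite pnatr_eq0.
have [mul _] : vector_form mu by case: hmu => _ [].
have [Mf Md] : vector_form (\sum_(i < r) N i) /\ of_degree 0 (\sum_(i < r) N i).
  by apply: degree_form_sum => i; have [[]] := hN i.
(* This is (n + 3) / 2 rounded up, the least arity that the lower bound on the [k i] allows. *)
have Mp : arity_ge (n + 4)./2 (\sum_(i < r) N i).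
  move=> X sX; rewrite fct_sumE big1 // => i _.
  have [[_ Nk] _] := hN i; apply: Nk; have := hk_lo i; lia.
have hp : (n + 3 <= 2 * (n + 4)./2)%N by lia.
split.
- exact: (nijenhuis_euler_add hmu Mf Md Mp hp).
- exact: (lie_n_algebra_deformed hmu Mf Md Mp hp two_neq0).
rewrite -[X in euler E + X]scale1r (rn_bracket_euler_add hmu) scale1r.
rewrite rn_bracket_suml //; congr (_ + _); apply: eq_bigr => i _.
by have [Nk Nd] := hN i; apply: (rn_bracket_arity_sum hmu).
Qed.
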